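(* Let $n,a,b,k$ be positive integers. If $b\ge n-k$, then Breaker has a winning strategy in the $(a:b)$ minimum-degree-$k$ Maker-Breaker game on $K_n$ in which Breaker moves first.
   Context: The $(a:b)$ minimum-degree-$k$ Maker-Breaker game on $K_n$: the board is the edge set of the complete graph $K_n$ on $n$ vertices. In each round Breaker first claims $b$ previously unclaimed edges, then Maker claims $a$ previously unclaimed edges (if fewer edges remain, a player claims all remaining ones). Maker wins if at the end of the game his edges form a spanning subgraph of minimum degree at least $k$; otherwise Breaker wins. *)

(* Defs.v *)
From mathcomp Require Import all_boot.

Set Implicit Arguments.
Unset Strict Implicit.
Unset Printing Implicit Defensive.

(* The (a : b) minimum-degree-k Maker-Breaker game on K_n, Breaker first.     *)

Definition board (n : nat) : {set {set 'I_n}} := [set e : {set 'I_n} | #|e| == 2].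

Definition move (n : nat) := {set {set 'I_n}}.

(* A (partial) play is the chronological list of the moves made so far.       *)
(* Breaker moves first, so the moves of even index are Breaker's and those of *)
(* odd index are Maker's.                                                     *)
Definition play (n : nat) := seq (move n).

Definition unclaimed (n : nat) (p : play n) : {set {set 'I_n}} :=
  board n :\: \bigcup_(S <- p) S.

Definition bias (a b i : nat) : nat := if odd i then a else b.

(* When the board is exhausted the only legal move is set0, so trailing empty *)
(* moves are tolerated; they do not affect the outcome.                       *)
Definition legal_move (n q : nat) (F : {set {set 'I_n}}) (S : move n) : bool :=
  (S \subset F) && (#|S| == minn q #|F|).

Definition legal_play (n a b : nat) (p : play n) : Prop :=
  forall i, i < size p ->
    legal_move (bias a b i) (unclaimed (take i p)) (nth set0 p i).

Definition complete (n : nat) (p : play n) : Prop := unclaimed p = set0.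

Definition maker_edges (n : nat) (p : play n) : {set {set 'I_n}} :=
  \bigcup_(i < size p | odd i) nth set0 p i.

Definition degree (n : nat) (E : {set {set 'I_n}}) (v : 'I_n) : nat :=
  #|[set e in E | v \in e]|.

Definition min_degree_geq (n k : nat) (E : {set {set 'I_n}}) : Prop :=
  forall v : 'I_n, k <= degree E v.

Definition maker_wins (n k : nat) (p : play n) : Prop :=
  min_degree_geq k (maker_edges p).

(* Strategies may depend on the whole history.  A Breaker strategy has to     *)
(* answer every legal history at which it is Breaker's turn by a legal move;  *)
(* hence, for a, b > 0, it can always be followed until the board is          *)
(* exhausted.                                                                 *)
Definition breaker_strategy (n a b : nat) (sigma : play n -> move n) : Prop :=
  forall p, legal_play a b p -> ~~ odd (size p) ->
    legal_move b (unclaimed p) (sigma p).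

Definition follows (n : nat) (sigma : play n -> move n) (p : play n) : Prop :=
  forall i, i < size p -> ~~ odd i -> nth set0 p i = sigma (take i p).

Definition breaker_winning_strategy (n a b k : nat)
    (sigma : play n -> move n) : Prop :=
  breaker_strategy a b sigma /\
  forall p, legal_play a b p -> follows sigma p -> complete p ->
    ~ maker_wins k p.

(* Main.v *)
Require Import Defs.
From mathcomp Require Import all_boot.

(** Breaker fixes a vertex v and opens by claiming n - k of the n - 1 edges at
    v. At most k - 1 edges at v remain, so Maker's final degree at v is below
    k however both players continue. *)

(** The vertex v has n - 1 edges ([card_star]), and Maker can never take an edge of the opening move
    ([maker_edges_sub]). Maker's degree at v is therefore at most (n - 1) - (n - k) < k
    ([maker_loses_at]). The opening fits into one move because n - k <= b; every later Breaker move
    only has to be legal. *)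

(** A legal move has a prescribed exact size, so the n - k chosen edges must be padded with other
    free edges. *)
Lemma exists_interpolating_set (T : finType) (m : nat) (X F : {set T}) :
    X \subset F -> #|X| <= m <= #|F| ->
  exists S : {set T}, [/\ X \subset S, S \subset F & #|S| = m].
Proof.
move=> sXF; elim: m => [|m IHm] /andP[leXm lemF].
  by exists X; split=> //; apply/eqP; rewrite -leqn0.
(* Either [X] already has size m + 1, or a set of size m grows by one element of [F]. *)
have [ltmX | leXm'] := ltnP m #|X|.
  by exists X; split=> //; apply/eqP; rewrite eqn_leq leXm.
have [|S [sXS sSF cardS]] := IHm; first by rewrite leXm' ltnW.
have /set0Pn[x /setDP[xF xS]] : F :\: S != set0.
  by rewrite setD_eq0; apply: contraL lemF => /subset_leq_card; rewrite cardS -leqNgt.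
exists (x |: S); split; last by rewrite cardsU1 xS cardS.
  exact: subset_trans (subsetUr _ _).
by rewrite subUset sub1set xF.
Qed.

Definition star {n : nat} (v : 'I_n) : {set {set 'I_n}} :=
  [set e in board n | v \in e].

(** Edges at v correspond bijectively to their other endpoint. *)
Lemma card_star {n : nat} (v : 'I_n) : #|star v| = n.-1.
Proof.
have -> : star v = [set [set v; w] | w in [set~ v]].
  apply/setP=> e; apply/idP/imsetP.
    rewrite !inE => /andP[/cards2P[x [y [neq_xy ->]]]].
    rewrite !inE => /orP[] /eqP ->; first by exists y; rewrite ?inE 1?eq_sym.
    by exists x; rewrite ?inE // setUC.
  by case=> w; rewrite !inE => neq_wv ->; rewrite cards2 (eq_sym v) neq_wv !inE eqxx.
rewrite card_in_imset ?cardsC1 ?card_ord // => x y; rewrite !inE => neq_xv _ eq_xy.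
have : x \in [set v; y] by rewrite -eq_xy !inE eqxx orbT.
by rewrite !inE (negPf neq_xv) => /eqP.
Qed.

Lemma unclaimed_nil (n : nat) : unclaimed [::] = board n.
Proof. by rewrite /unclaimed big_nil setD0. Qed.

Lemma maker_edges_sub {n a b : nat} {S : move n} {p : play n} :
  legal_play a b (S :: p) -> maker_edges (S :: p) \subset board n :\: S.
Proof.
move=> legal; apply/bigcupsP=> i odd_i.
have /andP[/subset_trans sub _] := legal i (ltn_ord i); apply: sub.
(* Maker's indices are odd, hence nonzero, so [S] is among the moves already made. *)
by case: i odd_i => [[|i] lt_i] //= _; rewrite setDS // big_cons subsetUl.
Qed.

Lemma maker_loses_at {n a b k : nat} {v : 'I_n} {X S : move n} {p : play n} :
    0 < k -> X \subset star v -> #|X| = n - k -> X \subset S ->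
    legal_play a b (S :: p) ->
  degree (maker_edges (S :: p)) v < k.
Proof.
move=> k_gt0 sXst cardX sXS /maker_edges_sub sub.
have le_deg : degree (maker_edges (S :: p)) v <= #|star v :\: X|.
  apply/subset_leq_card/subsetP=> e; rewrite inE => /andP[/(subsetP sub)].
  case/setDP=> eB eS ve; rewrite !inE ve andbT (contra (subsetP sXS e)) //=.
  by move: eB; rewrite inE.
apply: leq_ltn_trans le_deg _.
rewrite cardsD (setIidPr sXst) card_star cardX.
have n_gt0 : 0 < n := leq_ltn_trans (leq0n v) (ltn_ord v).
(* What remains is n <= k + (n - k), which also holds under truncated subtraction when k > n. *)
by rewrite ltn_psubLR // -(prednK n_gt0) addnC /= -leq_subLR.
Qed.

Theorem theorem13 (n a b k : nat)
    (n_gt0 : 0 < n) (a_gt0 : 0 < a) (b_gt0 : 0 < b) (k_gt0 : 0 < k)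
    (b_ge : n - k <= b) :
  exists sigma : play n -> move n, breaker_winning_strategy a b k sigma.
Proof.
pose v := Ordinal n_gt0.
have le_nk : n - k <= #|star v|.
  by rewrite card_star -subn1 leq_sub2l.
have sstB : star v \subset board n by apply/subsetP=> e; rewrite inE => /andP[].
have [||X [_ sXst cardX]] := @exists_interpolating_set _ (n - k) set0 (star v).
- exact: sub0set.
- by rewrite cards0.
pose good (p : play n) (S : move n) :=
  legal_move b (unclaimed p) S && ((p == [::]) ==> (X \subset S)).
(* The default [set0] is never reached: [sigmaP] shows that a good move always exists. *)
pose sigma p := odflt set0 [pick S | good p S].
have sigmaP p : good p (sigma p).
  rewrite /sigma; case: pickP => //= none; exfalso.
  pose Y := if p == [::] then X else set0.
  have [||S [sYS sSF cardS]] :=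
    @exists_interpolating_set _ (minn b #|unclaimed p|) Y (unclaimed p).
  - rewrite /Y; case: eqP => [->|_]; last exact: sub0set.
    by rewrite unclaimed_nil (subset_trans sXst).
  - rewrite geq_minr andbT /Y; case: eqP => [->|_]; last by rewrite cards0.
    rewrite unclaimed_nil leq_min cardX b_ge.
    exact: leq_trans le_nk (subset_leq_card sstB).
  have /negP[] := negbT (none S).
  by rewrite /good /legal_move sSF cardS eqxx /=; move: sYS; rewrite /Y; case: eqP.
exists sigma; split=> [p _ _|p legal follow _ /(_ v)].
  by have /andP[] := sigmaP p.
case: p => [|S p] in legal follow *.
  (* In the empty play Maker has degree 0 < k at [v]. *)
  by rewrite leqNgt /degree /maker_edges big_ord0 setIdE set0I cards0 k_gt0.
have S_def : S = sigma [::] := follow 0 isT isT.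
have /andP[_ /= sXS] := sigmaP [::]; rewrite -S_def in sXS.
by rewrite leqNgt (maker_loses_at k_gt0 sXst cardX sXS legal).
Qed.
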